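(* Let $p$ be a prime with $p\equiv 3\pmod 4$. Then $$\sum_{k=0}^{p-1}\frac{\binom{2k}{k}^2}{8^k}\equiv-\sum_{k=0}^{p-1}\frac{\binom{2k}{k}^2}{(-16)^k}\pmod{p^3}.$$
   Context: For a prime $p$ and rational numbers $a,b$ whose denominators are not divisible by $p$, $a\equiv b\pmod{p^m}$ means that $(a-b)/p^m$ is a rational number whose denominator is not divisible by $p$. *)

(* Defs.v *)
From mathcomp Require Import all_boot all_order all_algebra.
Set Implicit Arguments. Unset Strict Implicit. Unset Printing Implicit Defensive.
Import Order.TTheory GRing.Theory Num.Theory.
Local Open Scope ring_scope.

Definition p_integral (p : nat) (q : rat) : bool := ~~ (p %| `|denq q|%N)%N.

Definition rat_cong (p m : nat) (a b : rat) : Prop :=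
  [/\ p_integral p a, p_integral p b & p_integral p ((a - b) / (p ^ m)%:R)].

(* Main.v *)
Require Import Defs.
From HB Require Import structures.
From mathcomp Require Import all_boot all_order all_algebra.
From mathcomp Require Import ring zify.
Import Order.TTheory GRing.Theory Num.Theory.
Local Open Scope ring_scope.

(** Write p = 2n+1 = 4e+3, a_k = C(2k,k)^2/16^k, b_k = (-1)^k C(n,k) C(n+k,k) and
    d_k = (a_k - b_k)/p^2, so that (2k+2)^2 d_(k+1) = (2k+1)^2 d_k + b_k.  The two sums are
    the values at 2 and -1 of sum a_k z^k.  The polynomial sum b_k z^k is the shifted Legendre
    polynomial P_n(1-2z), which is antisymmetric under z -> 1-z since n is odd, so its values
    at 2 and -1 cancel, and it remains to see that sum d_k (2^k + (-1)^k) vanishes mod p.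

    Mod p, Q(z) = sum_(k<p) d_k z^k solves the inhomogeneous Legendre equation of degree -1/2
    with right-hand side (P_n(1-2z) - z^(p-1))/4.  In the coordinate X = (1+z)/(1-z), which
    sends z = -1 to X = 0, the operator becomes again the Legendre operator of degree -1/2,
    which has a two-term recurrence on even coefficients; hence there is an explicit linear
    form recovering the constant term of f from the image of f.  Applied to Q(z) + Q(1-z), and
    using the symmetry X -> -X to evaluate the contribution of z^(p-1) through the upper half
    of Q, it gives
      2 (Q(-1) + Q(2)) = sum_(j<=2e) (-1)^j / C(2e,j)^2 - 4 sum_j u_j C(n,2j),
    u_j being the coefficients of the form.  Up to factors the last sum is
    sum_(j<=e) (-1)^j C(2e+1,e+1+j)/(e+1+j), and the difference vanishes because both sums
    satisfy the same first-order recurrence in e. *)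

(** * Sums of reciprocal binomial coefficients *)

Lemma neq0_eq (R : nzRingType) (a b : R) : a != 0 -> a = b -> b != 0.
Proof. by move=> ? <-. Qed.

(** [field] leaves its nonvanishing conditions in a normal form of its own; each is matched up to
    [ring] with a hypothesis of the context. *)
Ltac nonzero_side :=
  repeat (apply/andP; split); rewrite ?oppr_eq0 ?oner_neq0 //;
  match goal with
  | H : is_true (negb _) |- _ => solve [apply: (neq0_eq _ _ _ H); ring]
  end.

Section ReciprocalBinomials.

Variables (F : fieldType) (M : nat).
(** This form allows F to have characteristic p, with [M] below p. *)
Hypothesis natr_unit : forall k, (0 < k <= M)%N -> k%:R != 0 :> F.

Lemma fact_natr_neq0 m : (m <= M)%N -> (m`!)%:R != 0 :> F.
Proof.
elim: m => [|m IH] mM; first by rewrite fact0 oner_neq0.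
by rewrite factS natrM mulf_neq0 // ?(natr_unit m.+1) // IH // ltnW.
Qed.

Lemma bin_natr_neq0 m j : (j <= m <= M)%N -> 'C(m, j)%:R != 0 :> F.
Proof.
case/andP=> jm mM; have := fact_natr_neq0 _ mM.
by rewrite -(bin_fact jm) natrM mulf_eq0 negb_or => /andP[].
Qed.

Definition alt_recip_sum m : F := \sum_(j < m.+1) (-1) ^+ j / 'C(m, j)%:R ^+ 2.

(* Found by Gosper's algorithm; multiplied by (-1)^j / C(m+1,j)^2 it telescopes the summand below. *)
Definition recip_cert m j : F :=
  2 * (3 * m%:R + 7) * j%:R - (5 * m%:R + 13) * (m%:R + 2) - 2 * j%:R ^+ 2.

(** With m = i + j, all binomials are multiples of C(m,j) by rational functions of i and j, so a
    rational identity remains. *)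
Lemma recip_telescope m j : (j <= m)%N -> (m.+2 <= M)%N ->
  (-1) ^+ j * (4 * m.+1%:R ^+ 2 * m.+2%:R ^+ 2 / 'C(m.+2, j)%:R ^+ 2
    + m.+2%:R ^+ 3 * m.+3%:R / 'C(m, j)%:R ^+ 2)
  = m.+1%:R ^+ 2 * ((-1) ^+ j.+1 * recip_cert m j.+1 / 'C(m.+1, j.+1)%:R ^+ 2)
    - m.+1%:R ^+ 2 * ((-1) ^+ j * recip_cert m j / 'C(m.+1, j)%:R ^+ 2) :> F.
Proof.
move=> jm mM.
have [i def_m] : exists i, m = (i + j)%N by exists (m - j)%N; lia.
have u1 : m.+1%:R != 0 :> F by rewrite natr_unit //; lia.
have u2 : m.+2%:R != 0 :> F by rewrite natr_unit //; lia.
have ui1 : i.+1%:R != 0 :> F by rewrite natr_unit //; lia.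
have ui2 : i.+2%:R != 0 :> F by rewrite natr_unit //; lia.
have uj1 : j.+1%:R != 0 :> F by rewrite natr_unit //; lia.
have uB : 'C(m, j)%:R != 0 :> F by rewrite bin_natr_neq0 //; lia.
have e1 : 'C(m.+1, j)%:R = 'C(m, j)%:R * m.+1%:R / i.+1%:R :> F.
  apply: (canRL (mulfK ui1)); rewrite -!natrM; congr _%:R.
  by have := mul_bin_down m.+1 j; rewrite /= def_m; lia.
have e2 : 'C(m.+1, j.+1)%:R = 'C(m, j)%:R * m.+1%:R / j.+1%:R :> F.
  apply: (canRL (mulfK uj1)); rewrite -!natrM; congr _%:R.
  by have := mul_bin_diag m.+1 j; rewrite /=; lia.
have e3 : 'C(m.+2, j)%:R = 'C(m, j)%:R * m.+1%:R * m.+2%:R / (i.+1%:R * i.+2%:R) :> F.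
  have -> : 'C(m.+2, j)%:R = 'C(m.+1, j)%:R * m.+2%:R / i.+2%:R :> F.
    apply: (canRL (mulfK ui2)); rewrite -!natrM; congr _%:R.
    by have := mul_bin_down m.+2 j; rewrite /= def_m; lia.
  by rewrite e1; field; nonzero_side.
rewrite e1 e2 e3 /recip_cert (exprS (-1) j).
move: ((-1) ^+ j) => sg; move: ('C(m, j)%:R) uB => B uB.
move: u1 u2; rewrite def_m => u1 u2; field.
by nonzero_side.
Qed.

(** Summing [recip_telescope] over j <= m leaves the end values of the certificate. The terms j =
    m+1, m+2 of [alt_recip_sum m.+2] lie outside that range and add up to 1 - 1/(m+2)^2, as m is
    even. *)
Lemma alt_recip_sum_rec m : (m.+2 <= M)%N -> ~~ odd m ->
  4 * m.+1%:R ^+ 2 * m.+2%:R ^+ 2 * alt_recip_sum m.+2 =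
  4 * m.+1%:R ^+ 2 * (m.+2%:R ^+ 2 - 1)
  + m.+1%:R ^+ 2 * (- recip_cert m m.+1 - recip_cert m 0)
  - m.+2%:R ^+ 3 * m.+3%:R * alt_recip_sum m.
Proof.
move=> mM even_m.
have u2 : m.+2%:R != 0 :> F by rewrite natr_unit //; lia.
have sgm : (-1) ^+ m = 1 :> F by rewrite -signr_odd (negPf even_m).
have := @telescope_sumr F 0 m.+1 (fun j => m.+1%:R ^+ 2 *
   ((-1) ^+ j * recip_cert m j / 'C(m.+1, j)%:R ^+ 2)) isT.
rewrite bin0 binn !expr1n !divr1 (exprS (-1) m) sgm expr0 mulr1 !mul1r.
rewrite (eq_big_nat _ _ (F2 := fun j => (-1) ^+ j * (4 * m.+1%:R ^+ 2 *
    m.+2%:R ^+ 2 / 'C(m.+2, j)%:R ^+ 2 + m.+2%:R ^+ 3 * m.+3%:R / 'C(m, j)%:R ^+ 2)));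
  last by move=> j jm; rewrite recip_telescope //; lia.
have -> : \sum_(0 <= j < m.+1) (-1) ^+ j * (4 * m.+1%:R ^+ 2 *
    m.+2%:R ^+ 2 / 'C(m.+2, j)%:R ^+ 2 + m.+2%:R ^+ 3 * m.+3%:R / 'C(m, j)%:R ^+ 2)
  = 4 * m.+1%:R ^+ 2 * m.+2%:R ^+ 2 *
      (\sum_(j < m.+1) (-1) ^+ j / 'C(m.+2, j)%:R ^+ 2)
    + m.+2%:R ^+ 3 * m.+3%:R * alt_recip_sum m :> F.
  rewrite big_mkord /alt_recip_sum !mulr_sumr -big_split /=.
  by apply: eq_bigr => j _; ring.
move=> E; apply: (addIr (m.+2%:R ^+ 3 * m.+3%:R * alt_recip_sum m)).
rewrite subrK [alt_recip_sum m.+2]big_ord_recr big_ord_recr /=.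
rewrite binn binSn (exprS (-1) m.+1) (exprS (-1) m) sgm.
move: E; set S := \sum_(j < _) _; move: (alt_recip_sum m) => Y E.
rewrite -addrA mulrDr addrAC E.
by field; nonzero_side.
Qed.

Definition alt_tail_sum e : F :=
  \sum_(j < e.+1) (-1) ^+ j * 'C(e.*2.+1, e.+1 + j)%:R / (e.+1 + j)%:R.

Lemma alt_tail_sum_rec e : (e.*2.+3 <= M)%N ->
  alt_tail_sum e.+1 = - alt_tail_sum e + 'C(e.*2.+1, e.+1)%:R *
    (e.+1%:R^-1 + 2 / e.*2.+3%:R + e.*2.+2%:R^-1).
Proof.
move=> eM.
have u1 : e.+1%:R != 0 :> F by rewrite natr_unit //; lia.
have u2 : e.*2.+2%:R != 0 :> F by rewrite natr_unit //; lia.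
have u3 : e.*2.+3%:R != 0 :> F by rewrite natr_unit //; lia.
(* For k = e+2+j, Pascal's rule twice gives C(2e+3,k)/k = C(2e+1,k)/k + C(2e+1,k-1)/k +
   C(2e+2,k-1)/k. By absorption and Pascal again, each of the last two is a sum of neighbouring
   binomials over 2e+2 or 2e+3, so with alternating signs both telescope. *)
pose h j : F := (-1) ^+ j * ('C(e.*2.+2, e.+1 + j)%:R / e.*2.+3%:R
  + 'C(e.*2.+1, e.+1 + j)%:R / e.*2.+2%:R).
have step j : (j < e.+2)%N -> (-1) ^+ j * 'C(e.+1.*2.+1, e.+2 + j)%:R / (e.+2 + j)%:R =
    - ((-1) ^+ j.+1 * 'C(e.*2.+1, e.+1 + j.+1)%:R / (e.+1 + j.+1)%:R) - (h j.+1 - h j).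
  move=> je; rewrite /h doubleS !addnS !addSn.
  have uk : (e + j).+2%:R != 0 :> F by rewrite natr_unit //; lia.
  have e1 : ('C(e.*2.+2, (e + j).+2)%:R + 'C(e.*2.+2, (e + j).+1)%:R) / e.*2.+3%:R
     = 'C(e.*2.+2, (e + j).+1)%:R / (e + j).+2%:R :> F.
    apply/eqP; rewrite eqr_div // -natrD -binS -!natrM; apply/eqP; congr _%:R.
    by have := mul_bin_diag e.*2.+3 (e + j).+1; rewrite /=; lia.
  have e2 : ('C(e.*2.+1, (e + j).+2)%:R + 'C(e.*2.+1, (e + j).+1)%:R) / e.*2.+2%:R
     = 'C(e.*2.+1, (e + j).+1)%:R / (e + j).+2%:R :> F.
    apply/eqP; rewrite eqr_div // -natrD -binS -!natrM; apply/eqP; congr _%:R.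
    by have := mul_bin_diag e.*2.+2 (e + j).+1; rewrite /=; lia.
  rewrite (exprS (-1) j) (binS e.*2.+2) natrD.
  have -> (x y : F) : x - (-1 * (-1) ^+ j * y - (-1) ^+ j *
      ('C(e.*2.+2, (e + j).+1)%:R / e.*2.+3%:R + 'C(e.*2.+1, (e + j).+1)%:R / e.*2.+2%:R))
    = x + (-1) ^+ j * (y + ('C(e.*2.+2, (e + j).+1)%:R / e.*2.+3%:R
          + 'C(e.*2.+1, (e + j).+1)%:R / e.*2.+2%:R)) by ring.
  rewrite addrACA -!mulrDl e1 e2 (binS e.*2.+1) natrD.
  by ring.
rewrite {1}/alt_tail_sum (eq_bigr _ (fun (j : 'I_e.+2) _ => step j (ltn_ord j))) big_split /= !sumrN.
rewrite -(big_mkord xpredT (fun j => h j.+1 - h j)) telescope_sumr //.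
have -> : h e.+2 = 0 by rewrite /h !bin_small ?mul0r ?addr0 ?mulr0 //; lia.
(* The shifted sum has two terms beyond row 2e+1, which vanish, and lacks j = 0, whence the 1/(e+1);
   [h 0] gives the rest. *)
rewrite big_ord_recr big_ord_recr /= [in X in - (X + _)]bin_small; last lia.
rewrite [in X in - (_ + X)]bin_small; last lia.
rewrite !mulr0 !mul0r !addr0 /alt_tail_sum big_ord_recl /h /= /bump /=.
under [X in _ = - (_ + X) + _]eq_bigr => j _ do rewrite add1n.
rewrite !addn0 (_ : 'C(e.*2.+2, e.+1) = 2 * 'C(e.*2.+1, e.+1))%N; last first.
  rewrite binS -(bin_sub (n := e.*2.+1) (m := e)); last lia.
  by rewrite (_ : e.*2.+1 - e = e.+1)%N; lia.
by rewrite natrM !expr0; ring.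
Qed.

(** Induction on e: both sides are 1 at e = 0, and the two recurrences, the first at m = 2e, carry
    the identity from e to e+1. *)
Lemma alt_recip_tail e : (e.*2.+1 <= M)%N ->
  e.+1%:R * 'C(e.*2.+1, e.+1)%:R * alt_recip_sum e.*2 =
  e.*2.+1%:R ^+ 2 * alt_tail_sum e.
Proof.
elim: e => [|e IH] eM.
  by rewrite /alt_recip_sum /alt_tail_sum !big_ord1 /= addn0 bin0 binn expr0 !expr1n !invr1 !mulr1.
have u0 : 2%:R != 0 :> F by rewrite natr_unit //; lia.
have u1 : e.+1%:R != 0 :> F by rewrite natr_unit //; lia.
have u1' : e.+2%:R != 0 :> F by rewrite natr_unit //; lia.
have u2 : e.*2.+1%:R != 0 :> F by rewrite natr_unit //; lia.
have u3 : e.*2.+2%:R != 0 :> F by rewrite natr_unit //; lia.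
have u4 : e.*2.+3%:R != 0 :> F by rewrite natr_unit //; lia.
have eC : 'C(e.*2.+3, e.+2)%:R = 2 * e.*2.+3%:R / e.+2%:R * 'C(e.*2.+1, e.+1)%:R :> F.
  rewrite mulrAC; apply: (canRL (mulfK u1')); rewrite -!natrM; congr _%:R.
  have := mul_bin_diag e.*2.+3 e.+1; have := mul_bin_diag e.*2.+2 e; rewrite /=.
  have := binS e.*2.+1 e; have := bin_sub (n := e.*2.+1) (m := e).
  rewrite (_ : e.*2.+1 - e = e.+1)%N; last lia.
  by move=> /(_ ltac:(lia)); lia.
have eV : alt_tail_sum e = e.+1%:R * 'C(e.*2.+1, e.+1)%:R * alt_recip_sum e.*2 / e.*2.+1%:R ^+ 2.
  by rewrite IH; [field; nonzero_side | lia].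
have u0' : 4 != 0 :> F by rewrite (_ : 4 = 2%:R * 2%:R :> F) ?mulf_neq0 //; ring.
have u5 : 4 * e.*2.+1%:R ^+ 2 * e.*2.+2%:R ^+ 2 != 0 :> F.
  by rewrite !mulf_neq0 ?expf_neq0.
have eM2 : (e.*2.+2 <= M)%N by lia.
have even2e : ~~ odd e.*2 by rewrite odd_double.
have eX := canRL (mulKf u5) (alt_recip_sum_rec _ eM2 even2e).
rewrite doubleS eX (alt_tail_sum_rec _ eM) eV eC.
rewrite /recip_cert; move: (alt_recip_sum _) ('C(_, _)%:R) => X C.
move: u2 u3 u4 u5; rewrite -!muln2 => u2 u3 u4 u5.
by field; nonzero_side; nonzero_side.
Qed.

End ReciprocalBinomials.

(** * The Legendre operator *)

Section LegendreSymmetry.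

Variable R : comNzRingType.
Implicit Types u v : R.

Definition legendre_coef n k : R := (-1) ^+ k * ('C(n, k) * 'C(n + k, k))%:R.

Lemma legendre_coef_small n k : (n < k)%N -> legendre_coef n k = 0.
Proof. by move=> nk; rewrite /legendre_coef bin_small // mul0n mulr0. Qed.

Lemma mul_bin_nested n m k : (k <= m <= n)%N ->
  ('C(n, k) * 'C(n - k, m - k) = 'C(n, m) * 'C(m, k))%N.
Proof.
case/andP=> km mn; have kn := leq_trans km mn.
have fpos : (0 < k`! * (m - k)`! * (n - m)`!)%N by rewrite !muln_gt0 !fact_gt0.
apply/eqP; rewrite -(eqn_pmul2r fpos); apply/eqP.
have mk : (m - k <= n - k)%N by lia.
have := bin_fact mk; rewrite (_ : n - k - (m - k) = n - m)%N; last lia.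
have := bin_fact mn; have := bin_fact km; have := bin_fact kn.
move: ('C(n, k)) ('C(n - k, m - k)) ('C(n, m)) ('C(m, k)) k`! (m - k)`! => A B C D x y.
move: (n - m)`! n`! m`! (n - k)`! => z t u v e1 e2 e3 e4.
rewrite (_ : A * B * _ = A * (x * (B * (y * z))))%N; last by ring.
rewrite (_ : C * D * _ = C * ((D * (x * y)) * z))%N; last by ring.
by rewrite e4 e1 e2 e3.
Qed.

(** By [mul_bin_nested] a summand is C(n,m) C(n,k) C(m,m-k), and Vandermonde's identity sums
    these. *)
Lemma bin_square_sum n m : (m <= n)%N ->
  (\sum_(k < n.+1) 'C(n, k) ^ 2 * 'C(n - k, n - m) = 'C(n, m) * 'C(n + m, m))%N.
Proof.
move=> mn; rewrite -binomial.Vandermonde big_distrr /=.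
rewrite (big_ord_widen_cond n.+1 xpredT (fun k => 'C(n, m) * ('C(n, k) * 'C(m, m - k)))%N) //=.
rewrite [RHS]big_mkcond; apply: eq_bigr => k _.
have kn : (k <= n)%N by rewrite -ltnS.
case: ifP => [|/negbT]; rewrite ltnS => km; last first.
  by rewrite ['C(n - k, _)]bin_small ?muln0 //; lia.
rewrite expnS expn1 -mulnA -(bin_sub (m := n - m)); last lia.
rewrite (_ : n - k - (n - m) = m - k)%N; last lia.
by rewrite mul_bin_nested ?km // (bin_sub (m := k)) // mulnCA.
Qed.

(** Homogeneous form, with z = u/(u+v), of P_n(1-2z) = sum C(n,k)^2 (-z)^k (1-z)^(n-k). Expanding v
    = -u + (u+v) on the right reduces it to [bin_square_sum]. *)
Lemma legendre_homogeneous n u v :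
  \sum_(k < n.+1) legendre_coef n k * u ^+ k * (u + v) ^+ (n - k) =
  \sum_(k < n.+1) ('C(n, k) ^ 2)%:R * (- u) ^+ k * v ^+ (n - k).
Proof.
transitivity (\sum_(k < n.+1) \sum_(m < n.+1)
    ('C(n, k) ^ 2 * 'C(n - k, n - m))%:R * ((- u) ^+ m * (u + v) ^+ (n - m))).
  rewrite exchange_big /=; apply: eq_bigr => m _.
  have mn : (m <= n)%N by rewrite -ltnS.
  by rewrite -mulr_suml -natr_sum bin_square_sum // /legendre_coef (exprNn u); ring.
apply: eq_bigr => k _; have kn : (k <= n)%N by rewrite -ltnS.
have {2}-> : v = - u + (u + v) by ring.
rewrite exprDn mulr_sumr (reindex_inj rev_ord_inj) /=.
rewrite [RHS](big_ord_widen_cond n.+1 xpredT (fun i => ('C(n, k) ^ 2)%:R * (- u) ^+ k *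
  ((- u) ^+ (n - k - i) * (u + v) ^+ i *+ 'C(n - k, i)))) /=; last by rewrite ltnS leq_subr.
rewrite [RHS]big_mkcond; apply: eq_bigr => i _.
have ilen : (i <= n)%N by rewrite -ltnS.
rewrite subSS subKn //; case: ifP => [|/negbT]; rewrite ltnS => ik; last first.
  by rewrite ['C(n - k, i)]bin_small ?muln0 ?mul0r //; lia.
rewrite natrM -mulr_natr (_ : n - i = k + (n - k - i))%N; last lia.
by rewrite exprD; ring.
Qed.

(** Swapping u and v on the right of [legendre_homogeneous] and reversing k multiplies it by
    (-1)^n. *)
Lemma legendre_antisym n u v : odd n ->
  \sum_(k < n.+1) legendre_coef n k * (u ^+ k + v ^+ k) * (u + v) ^+ (n - k) = 0.
Proof.
move=> odd_n; under eq_bigr do rewrite mulrDr mulrDl.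
rewrite big_split /= legendre_homogeneous addrC addrC [u + v]addrC.
rewrite legendre_homogeneous (reindex_inj rev_ord_inj) -big_split big1 //= => k _.
have kn : (k <= n)%N by rewrite -ltnS.
rewrite subSS bin_sub // subKn // -!mulrA -mulrDr (exprNn u) (exprNn v).
suff -> : (-1) ^+ (n - k) = - (-1) ^+ k :> R by ring.
by rewrite -signr_odd oddB // odd_n -[in RHS]signr_odd; case: (odd k); rewrite /= ?opprK.
Qed.

End LegendreSymmetry.

(** * The Legendre operator of degree -1/2 and its dual linear form *)

Section LegendreOperator.

Variable F : fieldType.
Implicit Types f g : {poly F}.

(** Four times (1-X^2) f'' - 2X f' + nu(nu+1) f at nu = -1/2, which clears the denominator of
    nu(nu+1) = -1/4. *)
Definition legendre_op f : {poly F} :=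
  4 *: (f^`()^`() - f^`()^`() * 'X^2) - 8 *: (f^`() * 'X) - f.

Lemma legendre_op_is_linear : linear legendre_op.
Proof.
move=> c f g; rewrite /legendre_op !(derivD, derivZ) -!mul_polyC; ring.
Qed.

HB.instance Definition _ :=
  GRing.isLinear.Build F {poly F} {poly F} *:%R legendre_op legendre_op_is_linear.

Lemma coef_legendre_op f m : (legendre_op f)`_m =
  4 * m.+2%:R * m.+1%:R * f`_m.+2 - m.*2.+1%:R ^+ 2 * f`_m.
Proof.
rewrite /legendre_op !(coefB, coefZ, coefMXn, coefMX, coef_deriv).
case: m => [|[|m]] /=; rewrite ?coef_deriv ?subn2 /= -?muln2; ring.
Qed.

Lemma deriv_natr k : (k%:R : {poly F})^`() = 0.
Proof. by rewrite -polyC_natr derivC. Qed.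

(** Multiplying by f avoids the truncated exponent k-1. *)
Lemma deriv_expM f k : (f ^+ k)^`() * f = k%:R * f^`() * f ^+ k.
Proof.
rewrite deriv_exp -mulr_natl; case: k => [|k] /=; last by rewrite exprSr; ring.
by rewrite !mul0r.
Qed.

Lemma deriv_expMM f g k l : (f ^+ k * g ^+ l)^`() * (f * g) =
  (k%:R * g * f^`() + l%:R * f * g^`()) * (f ^+ k * g ^+ l).
Proof.
rewrite derivM.
transitivity ((f ^+ k)^`() * f * g * g ^+ l + f ^+ k * f * ((g ^+ l)^`() * g)).
  by ring.
by rewrite !deriv_expM; ring.
Qed.

Lemma deriv2_expMM f g k l : f^`() = 1 -> g^`() = 1 ->
  (f ^+ k * g ^+ l)^`()^`() * (f * g) + (f ^+ k * g ^+ l)^`() * (f + g) =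
  (k%:R + l%:R) * (f ^+ k * g ^+ l) + (k%:R * g + l%:R * f) * (f ^+ k * g ^+ l)^`().
Proof.
move=> df dg; move: (deriv_expMM f g k l); rewrite df dg !mulr1.
move: (f ^+ k * g ^+ l) => h /(congr1 (@deriv F)).
rewrite !(derivM, derivD) !deriv_natr df dg => E.
transitivity (h^`()^`() * (f * g) + h^`() * (1 * g + f * 1)); first by ring.
by rewrite E; ring.
Qed.

Let a : {poly F} := 'X - 1.
Let b : {poly F} := 'X + 1.

(* Up to a power of [b], [a ^+ k * b ^+ l] is z^k in the coordinate z = (X-1)/(X+1). *)
Lemma legendre_op_mixed k l : (2 * (k + l) + 1)%:R = 0 :> F ->
  legendre_op (a ^+ k * b ^+ l) * (a * b) =
  2 * (k.*2.+1%:R ^+ 2 * a - (2 * k)%:R ^+ 2 * b) * (a ^+ k * b ^+ l).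
Proof.
move=> kl0; set f := a ^+ k * b ^+ l.
have El : 2 * (k%:R + l%:R) + 1 = 0 :> {poly F}.
  by rewrite -natrD -(natrM _ 2) -(natrD _ _ 1) -polyC_natr kl0.
have da : a^`() = 1 by rewrite derivB derivX -(polyC1 F) derivC subr0.
have db : b^`() = 1 by rewrite derivD derivX -(polyC1 F) derivC addr0.
have df : f^`() * (a * b) = (k%:R * b + l%:R * a) * f.
  by rewrite /f deriv_expMM da db !mulr1.
have ddf : f^`()^`() * (a * b) + f^`() * (2 * 'X) =
    (k%:R + l%:R) * f + (k%:R * b + l%:R * a) * f^`().
  rewrite -deriv2_expMM // -/f; congr (_ + _ * _).
  by rewrite /a /b; ring.
rewrite /legendre_op -!mul_polyC !polyC_natr.
transitivity (- 4 * (a * b) * (f^`()^`() * (a * b) + f^`() * (2 * 'X)) - a * b * f).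
  by rewrite /a /b; ring.
rewrite ddf; transitivity (- 4 * (a * b) * (k%:R + l%:R) * f
    - 4 * (k%:R * b + l%:R * a) * (f^`() * (a * b)) - a * b * f); first by ring.
rewrite df; apply/subr0_eq.
(* The difference of the two sides is a multiple of 2(k+l)+1, which is zero in F. *)
transitivity ((2 * (k%:R + l%:R) + 1) *
    (- (a ^+ 2 * (2 * (k%:R + l%:R) + 1) + 4 * a + 8 * k%:R * a) * f)).
  by rewrite /b /a -muln2; ring.
by rewrite El mul0r.
Qed.

(* Likewise [b ^+ l] stands for ((1-z)/2)^k, as 1-z = 2/(X+1). *)
Lemma legendre_op_pure k l : (2 * (k + l) + 1)%:R = 0 :> F ->
  legendre_op (b ^+ l) * b =
  (2 * k.*2.+1%:R ^+ 2 - (2 * k)%:R ^+ 2 * b) * b ^+ l.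
Proof.
move=> kl0; set f := b ^+ l.
have El : 2 * (k%:R + l%:R) + 1 = 0 :> {poly F}.
  by rewrite -natrD -(natrM _ 2) -(natrD _ _ 1) -polyC_natr kl0.
have db : b^`() = 1 by rewrite derivD derivX -(polyC1 F) derivC addr0.
have df : f^`() * b = l%:R * f by rewrite deriv_expM db mulr1.
have ddf : f^`()^`() * b + f^`() = l%:R * f^`().
  by have := congr1 (@deriv F) df; rewrite !derivM deriv_natr db mulr1 mul0r add0r.
rewrite /legendre_op -!mul_polyC !polyC_natr.
transitivity (4 * (2 - b) * b * (f^`()^`() * b + f^`() - f^`())
    - 8 * (b - 1) * (f^`() * b) - b * f); first by rewrite /b; ring.
rewrite ddf; transitivity (4 * (2 - b) * (l%:R - 1) * (f^`() * b)
    - 8 * (b - 1) * (f^`() * b) - b * f); first by ring.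
rewrite df; apply/subr0_eq.
transitivity ((2 * (k%:R + l%:R) + 1) *
    ((2 * (2 * l%:R - 2 * k%:R - 1) - b * (2 * l%:R + 1 - 2 * k%:R)) * f)).
  by rewrite -muln2; ring.
by rewrite El mul0r.
Qed.

(** Chosen so that, pairing with [coef_legendre_op] at m = 2j, the coefficient of f_(2j+2) cancels
    between the terms j and j+1. *)
Fixpoint dual_coef j : F :=
  if j is i.+1 then dual_coef i * (4 * (2 * i + 2)%:R * (2 * i + 1)%:R) / (4 * i + 5)%:R ^+ 2
  else 1.

Definition dual_form n f : F := \sum_(j < n.+1) dual_coef j * f`_j.*2.

Lemma dual_formD n f g : dual_form n (f + g) = dual_form n f + dual_form n g.
Proof.
by rewrite /dual_form -big_split; apply: eq_bigr => j _; rewrite coefD mulrDr.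
Qed.

Lemma dual_formN n f : dual_form n (- f) = - dual_form n f.
Proof.
by rewrite /dual_form -sumrN; apply: eq_bigr => j _; rewrite coefN mulrN.
Qed.

(** The pairing telescopes; its upper end carries the factor 2n+1 = 0. *)
Lemma dual_form_op n f : (2 * n + 1)%:R = 0 :> F ->
  (forall i, (i < n)%N -> (4 * i + 5)%:R != 0 :> F) ->
  dual_form n (legendre_op f) = - f`_0.
Proof.
move=> n0 nz.
suff H J : (J <= n)%N -> \sum_(j < J.+1) dual_coef j * (legendre_op f)`_j.*2
    = 4 * (2 * J + 2)%:R * (2 * J + 1)%:R * dual_coef J * f`_J.+1.*2 - f`_0.
  by rewrite /dual_form H // n0 mulr0 !mul0r sub0r.
elim: J => [|J IH] Jn; first by rewrite big_ord1 coef_legendre_op doubleS /= !double0; ring.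
rewrite big_ord_recr /= IH ?(ltnW Jn) // coef_legendre_op !doubleS -!muln2.
by have u := nz _ Jn; field; nonzero_side.
Qed.

Lemma coef_comp_polyN f i : (f \Po (- 'X))`_i = (-1) ^+ i * f`_i.
Proof.
elim/poly_ind: f i => [|f c IH] i; first by rewrite comp_poly0 !coef0 mulr0.
rewrite comp_polyD comp_polyM comp_polyX comp_polyC mulrN !coefD coefN !coefMX !coefC.
case: i => [|i] /=; first by rewrite oppr0 !add0r mul1r.
by rewrite IH !addr0 exprS mulN1r mulNr.
Qed.

Lemma dual_form_even n f : dual_form n (f \Po (- 'X)) = dual_form n f.
Proof.
apply: eq_bigr => j _.
by rewrite coef_comp_polyN -signr_odd odd_double mul1r.
Qed.

End LegendreOperator.

(** * The inhomogeneous equation in characteristic p *)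

Lemma natr_neq0_lt_pchar (F : fieldType) (p k : nat) : p \in [pchar F] ->
  (0 < k < p)%N -> k%:R != 0 :> F.
Proof.
move=> pF /andP[k0 kp]; rewrite -(dvdn_pcharf pF).
by apply: contraL kp => /dvdn_leq pk; rewrite -leqNgt pk.
Qed.

Lemma bin_pred_pchar (F : fieldType) (p k : nat) : p \in [pchar F] ->
  (k < p)%N -> 'C(p.-1, k)%:R = (-1) ^+ k :> F.
Proof.
move=> pF; have pp := pcharf_prime pF.
elim: k => [|k IH] kp; first by rewrite bin0.
have : 'C(p, k.+1)%:R = 0 :> F.
  by apply/eqP; rewrite -(dvdn_pcharf pF) prime_dvd_bin // kp.
rewrite -{1}(prednK (prime_gt0 pp)) binS natrD IH ?(ltnW kp) // => E.
by rewrite exprS mulN1r; apply/eqP; rewrite -addr_eq0 E.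
Qed.

Section InhomogeneousSolution.

Variables (F : fieldType) (p e : nat).
Hypotheses (pF : p \in [pchar F]) (p_def : p = (4 * e + 3)%N).
Let n := e.*2.+1.

(** [q] stands for the reductions of the d_k, known only through their recurrence. *)
Variable q : nat -> F.
Hypothesis q0 : q 0%N = 0.
Hypothesis q_rec : forall k, (k.+1 < p)%N ->
  (2 * k.+1)%:R ^+ 2 * q k.+1 = k.*2.+1%:R ^+ 2 * q k + legendre_coef F n k.

Let natr_unit k : (0 < k < p)%N -> k%:R != 0 :> F.
Proof. exact: natr_neq0_lt_pchar. Qed.

Let p0 : p%:R = 0 :> F.
Proof. exact: pcharf0. Qed.

Let eq_mod_p (x y : nat) : (x = y + p)%N -> x%:R = y%:R :> F.
Proof. by move=> ->; rewrite natrD p0 addr0. Qed.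

Lemma legendre_coef_top : legendre_coef F n n = 1.
Proof.
rewrite /legendre_coef binn mul1n (_ : n + n = p.-1)%N; last by rewrite /n; lia.
rewrite (bin_pred_pchar _ _ _ pF); last by rewrite /n; lia.
by rewrite -exprD addnn -signr_odd odd_double.
Qed.

(** At k = n the factor 2k+1 is p, so q_(n+1) = 1 regardless of the lower half. Beyond n the
    recurrence is homogeneous, and its ratio is that of the inverse squared binomials because
    2(2e-j) = -(2j+3) mod p. *)
Lemma solution_upper_half j : (j <= e.*2)%N -> q (n.+1 + j) = 'C(e.*2, j)%:R ^- 2.
Proof.
have small k : (0 < k <= e.*2)%N -> k%:R != 0 :> F by move=> ?; apply: natr_unit; lia.
elim: j => [|j IH] je.
  have := q_rec n ltac:(lia); rewrite legendre_coef_top addn0 bin0.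
  rewrite (_ : n.*2.+1 = p); last by rewrite /n; lia.
  rewrite p0 expr0n mul0r add0r (eq_mod_p (2 * n.+1) 1); last by rewrite /n; lia.
  by rewrite !expr1n !mul1r invr1.
have uC : 'C(e.*2, j)%:R != 0 :> F by apply: (bin_natr_neq0 _ _ small); lia.
have uC' : 'C(e.*2, j.+1)%:R != 0 :> F by apply: (bin_natr_neq0 _ _ small); lia.
have u2 : (e.*2 - j)%:R != 0 :> F by apply: natr_unit; lia.
have uj : j.+1%:R != 0 :> F by apply: natr_unit; lia.
have u3 : (2 * j + 3)%:R != 0 :> F by apply: natr_unit; lia.
have := q_rec (n.+1 + j) ltac:(lia).
rewrite legendre_coef_small ?addr0; last lia.
rewrite IH ?(ltnW je) // -addnS.
rewrite (eq_mod_p (2 * (n.+1 + j.+1)) (2 * j + 3)); last by rewrite /n; lia.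
rewrite (eq_mod_p (n.+1 + j).*2.+1 (2 * j.+1)); last by rewrite /n; lia.
have eC : 'C(e.*2, j.+1)%:R = (e.*2 - j)%:R / j.+1%:R * 'C(e.*2, j)%:R :> F.
  rewrite mulrAC; apply: (canRL (mulfK uj)); rewrite -!natrM; congr _%:R.
  by have := mul_bin_left e.*2 j; lia.
have ej : (2 * (e.*2 - j))%:R = - (2 * j + 3)%:R :> F.
  by apply/eqP; rewrite -addr_eq0 -natrD -p0; apply/eqP; congr _%:R; lia.
have u2' : 2%:R != 0 :> F by apply: natr_unit; lia.
have {ej} ej : (e.*2 - j)%:R = - (2 * j + 3)%:R / 2 :> F.
  by rewrite -ej natrM mulrAC mulfV ?mul1r.
move=> E; apply: (mulfI (expf_neq0 2 u3)); rewrite E eC ej.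
by field; nonzero_side.
Qed.

(** Abel summation with [q_rec]; the weights lie in a module because they will be polynomials. *)
Lemma solution_sum_by_parts (V : lmodType F) (w : nat -> V) s : (s < p)%N ->
  \sum_(s <= k < p) ((k.*2.+1%:R ^+ 2 * q k) *: w k.+1 - ((2 * k)%:R ^+ 2 * q k) *: w k) =
  w p - ((2 * s)%:R ^+ 2 * q s) *: w s - \sum_(s <= k < p) legendre_coef F n k *: w k.+1.
Proof.
have [m def_p] : exists m, p = m.+1 by exists p.-1; lia.
move=> sp; rewrite def_p in sp *; rewrite !big_nat_recr //=.
rewrite (legendre_coef_small F n m); last by rewrite /n; lia.
(* At the last index p-1, 2k+1 is -1 mod p and q is 1/C(2e,2e)^2, so [w p] gets coefficient 1. *)
have qm : m.*2.+1%:R ^+ 2 * q m = 1.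
  have -> : m = (n.+1 + e.*2)%N by rewrite /n; lia.
  rewrite solution_upper_half // binn expr1n invr1 mulr1 (_ : _.+1%:R = -1) ?sqrrN ?expr1n //.
  apply/eqP; rewrite -addr_eq0 natr1 (_ : _.+2 = 2 * p)%N; last by rewrite /n; lia.
  by rewrite natrM p0 mulr0.
rewrite scale0r addr0 qm scale1r.
rewrite (eq_big_nat _ _ (F2 := fun k => ((2 * k.+1)%:R ^+ 2 * q k.+1) *: w k.+1 -
  ((2 * k)%:R ^+ 2 * q k) *: w k - legendre_coef F n k *: w k.+1)); last first.
  move=> k /andP[_ km]; rewrite q_rec ?scalerDl; last lia.
  by rewrite [RHS]addrAC addrK.
rewrite sumrB telescope_sumr //; set A := _ *: w m; set B := _ *: w s.
by rewrite [LHS]addrC addrA addrA subrK.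
Qed.

(** * The equation in the coordinate X, with denominators cleared *)

Let a : {poly F} := 'X - 1.
Let b : {poly F} := 'X + 1.
(** 2N+1 = 3p vanishes in F, and N >= p keeps every exponent N-k meaningful. *)
Let N := (n + p)%N.

(** With z = a/b, [mixed 0] is b^N Q(z) and [pure] is b^N Q(1-z), since 1-z = 2/b. *)
Let mixed s : {poly F} := \sum_(s <= k < p) q k *: (a ^+ k * b ^+ (N - k)).
Let pure : {poly F} := \sum_(0 <= k < p) (q k * 2 ^+ k) *: b ^+ (N - k).

Let N_half k : (k < p)%N -> (2 * (k + (N - k)) + 1)%:R = 0 :> F.
Proof.
move=> kp; have -> : (2 * (k + (N - k)) + 1 = 3 * p)%N by rewrite /N /n; lia.
by rewrite natrM p0 mulr0.
Qed.

Lemma legendre_op_mixed_sum s : (s < p)%N ->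
  legendre_op F (mixed s) * (a * b) =
  2 * (a ^+ p * b ^+ n.+1 - ((2 * s)%:R ^+ 2 * q s) *: (a ^+ s * b ^+ (N.+1 - s))
    - \sum_(s <= k < p) legendre_coef F n k *: (a ^+ k.+1 * b ^+ (N - k))).
Proof.
move=> sp; have := solution_sum_by_parts {poly F} (fun k => a ^+ k * b ^+ (N.+1 - k)) s sp.
rewrite /= (_ : N.+1 - p = n.+1)%N; last by rewrite /N; lia.
under [X in _ = _ - X -> _]eq_bigr do rewrite subSS.
move=> <-; rewrite linear_sum mulr_suml mulr_sumr; apply: eq_big_nat => k /andP[_ kp].
rewrite linearZ /= -scalerAl legendre_op_mixed; last exact: N_half.
rewrite subSS (subSn (m := k)); last by rewrite /N; lia.
rewrite -!mul_polyC !(rmorphM, rmorphXn, rmorph_nat) /= ?(exprS a) (exprS b) ?(exprS 2).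
by rewrite -/a -/b; move: (b ^+ _) => c; ring.
Qed.

Lemma legendre_op_pure_sum :
  legendre_op F pure * b =
  2 * b ^+ n.+1
    - \sum_(0 <= k < p) legendre_coef F n k *: (2 ^+ k.+1 *: b ^+ (N - k)).
Proof.
have := solution_sum_by_parts {poly F} (fun k => 2 ^+ k *: b ^+ (N.+1 - k)) 0 ltac:(lia).
rewrite /= q0 mulr0 scale0r subr0 (_ : N.+1 - p = n.+1)%N; last by rewrite /N; lia.
have -> : 2 ^+ p *: b ^+ n.+1 = 2 * b ^+ n.+1.
  have := pFrobenius_aut_nat pF 2; rewrite pFrobenius_autE => ->.
  by rewrite -mul_polyC polyC_natr.
under [X in _ = _ - X -> _]eq_bigr do rewrite subSS.
move=> <-; rewrite linear_sum mulr_suml; apply: eq_big_nat => k /andP[_ kp].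
rewrite linearZ /= -scalerAl (legendre_op_pure _ k); last exact: N_half.
rewrite subSS (subSn (m := k)); last by rewrite /N; lia.
rewrite -!mul_polyC !(rmorphM, rmorphXn, rmorph_nat) /= ?(exprS a) (exprS b) ?(exprS 2).
by rewrite -/a -/b; move: (b ^+ _) => c; ring.
Qed.

Let a_neq0 : a != 0.
Proof. by rewrite /a -(polyC1 F) polyXsubC_eq0. Qed.

Let b_neq0 : b != 0.
Proof. by rewrite /b -(polyC1 F) -[1]opprK rmorphN polyXsubC_eq0. Qed.

(** Above n the Legendre coefficients vanish, so only the two boundary terms survive. *)
Lemma legendre_op_upper_mixed :
  legendre_op F (mixed n.+1) = 2 * (a ^+ p.-1 * b ^+ n - a ^+ n * b ^+ p.-1).
Proof.
have p_gt0 : (0 < p)%N by lia.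
apply: (mulIf (mulf_neq0 a_neq0 b_neq0)); rewrite legendre_op_mixed_sum; last first.
  by rewrite /n; lia.
rewrite big_nat big1 => [|k /andP[nk _]]; last by rewrite legendre_coef_small ?scale0r.
have := solution_upper_half 0 (leq0n _); rewrite addn0 bin0 expr1n invr1 => ->.
rewrite (eq_mod_p (2 * n.+1) 1); last by rewrite /n; lia.
rewrite expr1n mulr1 scale1r subr0 (_ : N.+1 - n.+1 = p.-1.+1)%N; last by rewrite /N; lia.
by rewrite -{1}(prednK p_gt0) !(exprS a) !(exprS b); ring.
Qed.

Lemma legendre_op_total :
  legendre_op F (mixed 0 + pure) = 2 * (a ^+ p.-1 * b ^+ n + b ^+ n).
Proof.
have p_gt0 : (0 < p)%N by lia.
apply: (mulIf (mulf_neq0 a_neq0 b_neq0)); rewrite linearD /= mulrDl.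
rewrite legendre_op_mixed_sum // muln0 expr0n mul0r scale0r subr0.
rewrite [X in _ + X](_ : _ = legendre_op F pure * b * a); last by ring.
rewrite legendre_op_pure_sum.
(* The inhomogeneous terms of [mixed 0] and [pure] cancel by [legendre_antisym] at u = X-1, v = 2,
   where u+v = X+1. *)
have sum0 : 2 * (\sum_(0 <= k < p) legendre_coef F n k *: (a ^+ k.+1 * b ^+ (N - k)))
    + (\sum_(0 <= k < p) legendre_coef F n k *: (2 ^+ k.+1 *: b ^+ (N - k))) * a = 0.
  have odd_n : odd n by rewrite /= odd_double.
  have ab : b = a + 2 by rewrite /a /b; ring.
  have := legendre_antisym {poly F} n a 2 odd_n; rewrite -ab.
  move/(congr1 (fun x => 2 * a * b ^+ p * x)); rewrite mulr0 mulr_sumr => E; rewrite -[RHS]E.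
  rewrite (big_cat_nat _ (n := n.+1)) //=; last by rewrite /n; lia.
  rewrite [X in 2 * (_ + X)]big_nat [X in 2 * (_ + X)]big1 => [|k /andP[nk _]]; last first.
    by rewrite legendre_coef_small ?scale0r.
  rewrite [X in _ + X * a](big_cat_nat _ (n := n.+1)) //=; last by rewrite /n; lia.
  rewrite [X in _ + (_ + X) * a]big_nat [X in _ + (_ + X) * a]big1 => [|k /andP[nk _]]; last first.
    by rewrite legendre_coef_small ?scale0r.
  rewrite !addr0 !big_mkord mulr_sumr mulr_suml -big_split; apply: eq_bigr => k _ /=.
  have kn : (k <= n)%N by rewrite -ltnS.
  rewrite (_ : N - k = p + (n - k))%N; last by rewrite /N; lia.
  rewrite exprD -!mul_polyC /legendre_coef !(rmorphM, rmorphXn, rmorph_nat, rmorphN1) /=.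
  by rewrite (exprS a) (exprS 2); ring.
transitivity (2 * (a ^+ p * b ^+ n.+1) + 2 * b ^+ n.+1 * a - 0); last first.
  by rewrite -{1}(prednK p_gt0) !(exprS a) !(exprS b); ring.
by rewrite -[X in _ = _ - X]sum0; ring.
Qed.

(** 4i+5 is less than 2p and differs from p, being 1 mod 4 while p is 3 mod 4. *)
Lemma natr_4i5_neq0 i : (i < n)%N -> (4 * i + 5)%:R != 0 :> F.
Proof.
move=> ltin; have ltin' : (i <= e.*2)%N by rewrite -ltnS.
have [lt_p | ge_p] := ltnP (4 * i + 5) p; first by apply: natr_unit; lia.
by rewrite (eq_mod_p _ (4 * i + 5 - p)); [apply: natr_unit|]; lia.
Qed.

Lemma dual_form_opE f : dual_form F n (legendre_op F f) = - f.[0].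
Proof.
rewrite dual_form_op ?horner_coef0 //; last exact: natr_4i5_neq0.
by rewrite -[RHS]p0; congr _%:R; rewrite /n; lia.
Qed.

(** X -> -X sends a to -b and b to -a; as n is odd and p-1 even, the two terms of
    [legendre_op_upper_mixed] have opposite forms, and their difference doubles. *)
Lemma dual_form_upper :
  4 * dual_form F n (a ^+ p.-1 * b ^+ n) = - (mixed n.+1).[0].
Proof.
rewrite -dual_form_opE legendre_op_upper_mixed [2 * (_ - _)]mulr_natl mulr2n !dual_formD !dual_formN.
have -> : dual_form F n (a ^+ n * b ^+ p.-1) = - dual_form F n (a ^+ p.-1 * b ^+ n).
  rewrite -dual_form_even comp_polyM !rmorphXn /= -dual_formN; congr dual_form.
  have -> : a \Po - 'X = - b by rewrite /a /b comp_polyB comp_polyX -(polyC1 F) comp_polyC; ring.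
  have -> : b \Po - 'X = - a by rewrite /a /b comp_polyD comp_polyX -(polyC1 F) comp_polyC; ring.
  rewrite (exprNn b) (exprNn a) -[(-1) ^+ n]signr_odd -[(-1) ^+ p.-1]signr_odd.
  rewrite [odd n]/= odd_double (_ : odd p.-1 = false); last by lia.
  by rewrite expr1 expr0; ring.
by ring.
Qed.

(** Both sides have the same ratio from j to j+1, since 4j+5 = 4(e+2+j) and n-2j = -2(e+1+j) mod
    p. *)
Lemma dual_coef_bin j : (j <= e)%N ->
  dual_coef F j * 'C(n, j.*2)%:R * 'C(n, e.+1)%:R =
  e.+1%:R * ((-1) ^+ j * 'C(n, e.+1 + j)%:R / (e.+1 + j)%:R).
Proof.
have u4 : 4%:R != 0 :> F.
  by rewrite (natrM F 2 2) mulf_neq0 //; apply: natr_unit; lia.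
elim: j => [|j IH] je.
  have u : e.+1%:R != 0 :> F by apply: natr_unit; lia.
  by rewrite double0 bin0 addn0 expr0 /= !mul1r mulrC divfK.
have u1 : (2 * j + 2)%:R != 0 :> F by apply: natr_unit; lia.
have u2 : (2 * j + 1)%:R != 0 :> F by apply: natr_unit; lia.
have u3 : (e.+1 + j)%:R != 0 :> F by apply: natr_unit; lia.
have u5 : (e.+2 + j)%:R != 0 :> F by apply: natr_unit; lia.
have e1 : (4 * j + 5)%:R = 4%:R * (e.+2 + j)%:R :> F.
  by rewrite -natrM -(eq_mod_p (4 * (e.+2 + j))) //; lia.
have e2 : 'C(n, j.+1.*2)%:R = (n - j.*2)%:R * (2 * (e - j))%:R / ((2 * j + 2)%:R * (2 * j + 1)%:R)
    * 'C(n, j.*2)%:R :> F.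
  rewrite mulrAC; apply: (canRL (mulfK (mulf_neq0 u1 u2))); rewrite -!natrM; congr _%:R.
  have := mul_bin_left n j.*2; have := mul_bin_left n j.*2.+1.
  rewrite (_ : n - j.*2.+1 = 2 * (e - j))%N; last by rewrite /n; lia.
  rewrite doubleS (_ : 2 * j + 1 = j.*2.+1)%N; last lia.
  rewrite (_ : 2 * j + 2 = j.*2.+2)%N; last lia.
  move=> E1 E2.
  transitivity (j.*2.+1 * (j.*2.+2 * 'C(n, j.*2.+2)))%N; first by ring.
  by rewrite E1 mulnCA E2; ring.
have e3 : (n - j.*2)%:R = - (2 * (e.+1 + j))%:R :> F.
  by apply/eqP; rewrite -addr_eq0 -natrD -p0; apply/eqP; congr _%:R; rewrite /n; lia.
have e4 : 'C(n, e.+1 + j.+1)%:R = (e - j)%:R / (e.+2 + j)%:R * 'C(n, e.+1 + j)%:R :> F.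
  rewrite mulrAC; apply: (canRL (mulfK u5)); rewrite -!natrM; congr _%:R.
  have := mul_bin_left n (e.+1 + j); rewrite (_ : n - (e.+1 + j) = e - j)%N; last by rewrite /n; lia.
  by rewrite addnS addSn; lia.
have := IH (ltnW je); rewrite /= e1 e2 e3 e4 addnS (exprS (-1) j) => E.
transitivity (dual_coef F j * 'C(n, j.*2)%:R * 'C(n, e.+1)%:R *
    (- (e.+1 + j)%:R * (e - j)%:R / (e.+2 + j)%:R ^+ 2)).
  by field; nonzero_side.
by rewrite E; field; nonzero_side.
Qed.

Lemma coef_XD1n m i : (('X + 1 : {poly F}) ^+ m)`_i = 'C(m, i)%:R.
Proof.
elim: m i => [|m IH] [|i]; rewrite ?expr0 ?coef1 ?bin0 // exprSr mulrDr mulr1 coefD coefMX IH.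
  by rewrite bin0 add0r.
by rewrite IH binS natrD addrC.
Qed.

Lemma dual_form_pure :
  dual_form F n (b ^+ n) * 'C(n, e.+1)%:R = e.+1%:R * alt_tail_sum F e.
Proof.
rewrite /dual_form mulr_suml /alt_tail_sum mulr_sumr.
rewrite [RHS](big_ord_widen n.+1 (fun j : nat => e.+1%:R * ((-1) ^+ j *
  'C(n, e.+1 + j)%:R / (e.+1 + j)%:R))); last by rewrite /n; lia.
rewrite [RHS]big_mkcond; apply: eq_bigr => j _; rewrite coef_XD1n.
case: ifP => [je | /negbT je]; first by rewrite dual_coef_bin.
by rewrite bin_small ?mulr0 ?mul0r // /n; move: (nat_of_ord j) je => i; lia.
Qed.

(** Evaluation at X = 0, where a = -1 and b = 1, that is z = -1 and 1-z = 2. *)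
Lemma inhomogeneous_values_cancel : \sum_(0 <= k < p) q k * (2 ^+ k + (-1) ^+ k) = 0.
Proof.
have nz2 : 2 != 0 :> F by apply: (natr_unit 2); lia.
have a0 : a.[0] = -1 by rewrite /a !hornerE.
have b0 : b.[0] = 1 by rewrite /b !hornerE.
have mixed0 s : (mixed s).[0] = \sum_(s <= k < p) q k * (-1) ^+ k.
  rewrite horner_sum; apply: eq_bigr => k _.
  by rewrite hornerZ hornerM !horner_exp a0 b0 expr1n mulr1.
have total0 : (mixed 0 + pure).[0] = \sum_(0 <= k < p) q k * (2 ^+ k + (-1) ^+ k).
  rewrite hornerD mixed0 horner_sum -big_split; apply: eq_bigr => k _ /=.
  by rewrite hornerZ !horner_exp b0 expr1n mulr1 mulrDr addrC.
have upper0 : (mixed n.+1).[0] = alt_recip_sum F e.*2.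
  rewrite mixed0 -{1}[n.+1]add0n big_addn big_mkord /alt_recip_sum.
  rewrite (_ : p - n.+1 = e.*2.+1)%N; last by rewrite /n; lia.
  apply: eq_bigr => j _; rewrite addnC solution_upper_half -1?ltnS // mulrC exprD.
  by rewrite -[(-1) ^+ n.+1]signr_odd /= odd_double mul1r.
have small k : (0 < k <= n)%N -> k%:R != 0 :> F.
  by rewrite /n => kn; apply: natr_unit; lia.
have uC : 'C(n, e.+1)%:R != 0 :> F by apply: (bin_natr_neq0 _ _ small); rewrite /n; lia.
have ue : e.+1%:R != 0 :> F by apply: natr_unit; lia.
have X4 : alt_recip_sum F e.*2 = 4 * dual_form F n (b ^+ n).
  apply: (mulfI (mulf_neq0 ue (mulf_neq0 ue uC))).
  (* This turns the factor (2e+1)^2 of [alt_recip_tail] into 4(e+1)^2, the source of the 4. *)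
  have n_half : n%:R = - (2 * e.+1%:R) :> F.
    by apply/eqP; rewrite -addr_eq0 -natrM -natrD -p0; apply/eqP; congr _%:R; rewrite /n; lia.
  have E1 := alt_recip_tail F n small e (leqnn _); have E2 := dual_form_pure.
  transitivity (e.+1%:R * (e.+1%:R * 'C(n, e.+1)%:R * alt_recip_sum F e.*2)); first by ring.
  rewrite E1 -/n n_half; transitivity (4 * e.+1%:R ^+ 2 * (e.+1%:R * alt_tail_sum F e)); first by ring.
  by rewrite -E2; ring.
have D1 := dual_form_upper; rewrite upper0 X4 in D1.
have D2 := dual_form_opE (mixed 0 + pure).
rewrite legendre_op_total total0 [2 * (_ + _)]mulr_natl mulr2n !dual_formD in D2.
apply: (mulfI nz2); rewrite mulr0 -[X in 2 * X]opprK -D2.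
transitivity (- (4 * dual_form F n (a ^+ p.-1 * b ^+ n)) - 4 * dual_form F n (b ^+ n)); first by ring.
by rewrite D1; ring.
Qed.

End InhomogeneousSolution.

(** * Reduction of rational numbers modulo p *)

Section Reduction.

Variables (p : nat) (F : fieldType).
Hypothesis pF : p \in [pchar F].

(** Reduction mod p as a relation witnessed by a fraction c/d with d invertible in F, which avoids
    constructing the localization of the integers at p. *)
Definition reduces (x : rat) (y : F) := exists c d : int,
  [/\ d%:~R != 0 :> F, x * d%:~R = c%:~R & y * d%:~R = c%:~R].

Lemma intr_eq0_pchar (d : int) : (d%:~R == 0 :> F) = (p %| `|d|)%N.
Proof.
rewrite (dvdn_pcharf pF); case: (intP d) => [|m|m]; rewrite ?abszN // mulrNz oppr_eq0.
by [].
Qed.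

Lemma reduces_int (z : int) : reduces z%:~R z%:~R.
Proof. by exists z, 1; rewrite !mulr1 oner_neq0. Qed.

Lemma reduces_nat k : reduces k%:R k%:R.
Proof. exact: (reduces_int k). Qed.

Lemma reducesD x1 y1 x2 y2 : reduces x1 y1 -> reduces x2 y2 -> reduces (x1 + x2) (y1 + y2).
Proof.
move=> [c1 [d1 [nz1 E1 E1']]] [c2 [d2 [nz2 E2 E2']]].
exists (c1 * d2 + c2 * d1), (d1 * d2); split; first by rewrite intrM mulf_neq0.
- by rewrite intrD !intrM -E1 -E2; ring.
- by rewrite intrD !intrM -E1' -E2'; ring.
Qed.

Lemma reducesM x1 y1 x2 y2 : reduces x1 y1 -> reduces x2 y2 -> reduces (x1 * x2) (y1 * y2).
Proof.
move=> [c1 [d1 [nz1 E1 E1']]] [c2 [d2 [nz2 E2 E2']]].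
exists (c1 * c2), (d1 * d2); split; first by rewrite intrM mulf_neq0.
- by rewrite !intrM -E1 -E2; ring.
- by rewrite !intrM -E1' -E2'; ring.
Qed.

Lemma reducesX x y k : reduces x y -> reduces (x ^+ k) (y ^+ k).
Proof.
move=> xy; elim: k => [|k IH]; first by rewrite !expr0; apply: (reduces_nat 1).
by rewrite !exprS; apply: reducesM.
Qed.

Lemma reducesV x y : y != 0 -> reduces x y -> reduces x^-1 y^-1.
Proof.
move=> nzy [c [d [nzd E E']]].
have nzc : c%:~R != 0 :> F by rewrite -E' mulf_neq0.
have nzcr : c%:~R != 0 :> rat.
  by rewrite intr_eq0; apply: contraNneq nzc => ->.
have nzx : x != 0 by apply: contraNneq nzcr => x0; rewrite -E x0 mul0r.
by exists d, c; split=> //; rewrite -1?E -1?E' mulKf.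
Qed.

Lemma reduces_sum (x : nat -> rat) (y : nat -> F) m :
  (forall k, (k < m)%N -> reduces (x k) (y k)) ->
  reduces (\sum_(0 <= k < m) x k) (\sum_(0 <= k < m) y k).
Proof.
elim: m => [|m IH] xy; first by rewrite !big_geq //; apply: (reduces_nat 0).
rewrite !big_nat_recr //=; apply: reducesD; last exact: xy.
by apply: IH => k km; apply: xy; apply: ltnW.
Qed.

Lemma reduces_integral x y : reduces x y -> p_integral p x.
Proof.
move=> [c [d [nzd E _]]]; rewrite /p_integral; apply: contra nzd => p_den.
rewrite intr_eq0_pchar; apply: dvdn_trans p_den _.
have : (numq x * d = c * denq x)%R.
  apply/eqP; rewrite -(eqr_int rat) !intrM -E numqE; apply/eqP; ring.
move=> E1; have : (denq x %| numq x * d)%Z by rewrite E1 dvdz_mull.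
by rewrite Gauss_dvdzr // coprimez_sym; apply: coprime_num_den.
Qed.

Lemma reduces0_integral x : reduces x 0 -> p_integral p (x / p%:R).
Proof.
move=> [c [d [nzd E /esym/eqP]]]; rewrite mul0r intr_eq0_pchar => p_c.
have nzp : p%:R != 0 :> rat by rewrite pnatr_eq0 -lt0n prime_gt0 // (pcharf_prime pF).
have /dvdzP[c' def_c] : (p %| c)%Z by [].
apply: (@reduces_integral _ (c'%:~R / d%:~R)); exists c', d; split=> //.
  by rewrite mulrAC E def_c intrM mulfK.
by rewrite divfK.
Qed.

End Reduction.

(** * Recurrences for a_k, b_k and d_k, and the reduction of d_k *)

Lemma bin_central_rec k : (k.+1 * 'C(2 * k.+1, k.+1) = 2 * k.*2.+1 * 'C(2 * k, k))%N.
Proof.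
have := mul_bin_diag (2 * k.+1) k; rewrite (_ : (2 * k.+1).-1 = (2 * k).+1)%N; last lia.
have := mul_bin_down (2 * k).+1 k; rewrite /= (_ : (2 * k).+1 - k = k.+1)%N; last lia.
move=> E1 E2; apply/eqP; rewrite -(eqn_pmul2l (ltn0Sn k)) -E2; apply/eqP.
transitivity (2 * k.+1 * (k.+1 * 'C((2 * k).+1, k)))%N; first by ring.
by rewrite -E1 (_ : k.*2.+1 = (2 * k).+1)%N; [ring | lia].
Qed.

(** Rests on 4(n-k)(n+k+1) = (2n+1)^2 - (2k+1)^2. *)
Lemma legendre_coef_rec (R : comNzRingType) n k :
  (2 * k.+1)%:R ^+ 2 * legendre_coef R n k.+1 =
  (k.*2.+1%:R ^+ 2 - n.*2.+1%:R ^+ 2) * legendre_coef R n k.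
Proof.
have [nk | kn] := ltnP n k.
  by rewrite /legendre_coef (bin_small nk) (bin_small (leqW nk)) !mul0n !mulr0.
have E : (k.+1 ^ 2 * ('C(n, k.+1) * 'C(n + k.+1, k.+1)) =
    (n - k) * (n + k).+1 * ('C(n, k) * 'C(n + k, k)))%N.
  have := mul_bin_left n k; have := mul_bin_diag (n + k).+1 k; rewrite /= addnS.
  move=> E1 E2; transitivity ((k.+1 * 'C(n, k.+1)) * (k.+1 * 'C((n + k).+1, k.+1)))%N.
    by ring.
  by rewrite E2 -E1; ring.
rewrite /legendre_coef (exprS (-1)); transitivity (- 4 * (-1) ^+ k * (k.+1 ^ 2 *
    ('C(n, k.+1) * 'C(n + k.+1, k.+1)))%:R : R); first by rewrite !natrM; ring.
by rewrite E !natrM natrB // -!muln2; ring.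
Qed.

Section Defect.

Variables (n : nat) (F : fieldType).
Let p := n.*2.+1.

Definition central_coef k : rat := ('C(2 * k, k) ^ 2)%:R / 16 ^+ k.

Definition defect k : rat := (central_coef k - legendre_coef rat n k) / p%:R ^+ 2.

Lemma central_coef_rec k :
  (2 * k.+1)%:R ^+ 2 * central_coef k.+1 = k.*2.+1%:R ^+ 2 * central_coef k.
Proof.
rewrite /central_coef (natrX _ _ 2) [in RHS](natrX _ _ 2) (exprS 16).
have E : k.+1%:R * 'C(2 * k.+1, k.+1)%:R = 2 * k.*2.+1%:R * 'C(2 * k, k)%:R :> rat.
  by rewrite -!natrM bin_central_rec.
have : 16 ^+ k != 0 :> rat by rewrite expf_neq0.
move: (16 ^+ k) => s nz; transitivity (4 * (k.+1%:R * 'C(2 * k.+1, k.+1)%:R) ^+ 2 / 16 / s : rat).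
  by rewrite natrM; field.
by rewrite E; field.
Qed.

Lemma defect_rec k :
  (2 * k.+1)%:R ^+ 2 * defect k.+1 = k.*2.+1%:R ^+ 2 * defect k + legendre_coef rat n k.
Proof.
have nzp : p%:R != 0 :> rat by rewrite pnatr_eq0.
rewrite /defect mulrA mulrBr central_coef_rec legendre_coef_rec -/p.
by field.
Qed.

Fixpoint reduced_defect k : F :=
  if k is j.+1 then
    (j.*2.+1%:R ^+ 2 * reduced_defect j + legendre_coef F n j) / (2 * j.+1)%:R ^+ 2
  else 0.

Lemma reduces_legendre_coef k : reduces F (legendre_coef rat n k) (legendre_coef F n k).
Proof.
have := reduces_int F (legendre_coef int n k).
by rewrite /legendre_coef !(rmorphM, rmorphXn, rmorphN1, rmorph_nat).
Qed.

Hypothesis pF : p \in [pchar F].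

Lemma double_neq0 j : (j.+1 < p)%N -> (2 * j.+1)%:R != 0 :> F.
Proof.
move=> jp; have pp := pcharf_prime pF.
have p_gt2 : (2 < p)%N by have := prime_gt1 pp; rewrite /p; lia.
by rewrite natrM mulf_neq0 // (natr_neq0_lt_pchar _ _ _ pF) // p_gt2.
Qed.

(** The recurrence divides only by (2k+2)^2, a unit mod p for k+1 < p, so the d_k are p-integral by
    induction from d_0 = 0. *)
Lemma reduces_defect k : (k < p)%N -> reduces F (defect k) (reduced_defect k).
Proof.
elim: k => [|k IH] kp.
  rewrite /defect /central_coef /legendre_coef !bin0 exp1n muln1 !expr0 !mulr1n !invr1 !mulr1 subrr mul0r.
  exact: (reduces_nat F 0).
have nz := double_neq0 _ kp.
have nzr : (2 * k.+1)%:R != 0 :> rat by rewrite pnatr_eq0.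
rewrite -[defect _](mulKf (expf_neq0 2 nzr)) defect_rec mulrC.
apply: reducesM; last by apply: reducesV; [rewrite expf_neq0|apply: reducesX; apply: reduces_nat].
apply: reducesD; last exact: reduces_legendre_coef.
by apply: reducesM; [apply: reducesX; apply: reduces_nat | apply: IH; apply: ltnW].
Qed.

End Defect.

Theorem theorem1p1 (p : nat) (hp : prime p) (h3 : (p %% 4 = 3)%N) :
  rat_cong p 3
    (\sum_(0 <= k < p) ('C(2 * k, k) ^ 2)%:R / (8 ^+ k : rat))
    (- \sum_(0 <= k < p) ('C(2 * k, k) ^ 2)%:R / ((-16) ^+ k : rat)).
Proof.
have [e def_p] : exists e, p = (4 * e + 3)%N by exists (p %/ 4)%N; lia.
set n := e.*2.+1; have p2n : p = n.*2.+1 by rewrite /n; lia.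
have pF : p \in [pchar 'F_p] by exact: pchar_Fp.
have nz2 : 2%:R != 0 :> 'F_p by apply: (natr_neq0_lt_pchar _ p) => //; lia.
have nzp : p%:R != 0 :> rat by rewrite pnatr_eq0; lia.
have integral_sum (c z : rat) (c' z' : 'F_p) :
    reduces 'F_p c c' -> z' != 0 -> reduces 'F_p z z' ->
    p_integral p (c * \sum_(0 <= k < p) ('C(2 * k, k) ^ 2)%:R / z ^+ k).
  move=> cc' nz zz'; apply: (@reduces_integral p 'F_p pF _
    (c' * \sum_(0 <= k < p) ('C(2 * k, k) ^ 2)%:R / z' ^+ k)).
  apply: reducesM => //; apply: reduces_sum => k _; apply: reducesM; first exact: reduces_nat.
  by apply: reducesV; [rewrite expf_neq0 | apply: reducesX].
split.
- rewrite -[X in p_integral _ X]mul1r.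
  apply: (integral_sum _ _ 1 (2%:R ^+ 3)); first exact: (reduces_nat _ 1).
    by rewrite expf_neq0.
  by rewrite (_ : 8 = 2%:R ^+ 3 :> rat) //; apply: reducesX; apply: reduces_nat.
- rewrite -[X in p_integral _ X]mulN1r; apply: (integral_sum _ _ (-1) (- 2%:R ^+ 4)).
  + exact: (reduces_int _ (-1)).
  + by rewrite oppr_eq0 expf_neq0.
  by rewrite -natrX; apply: (reduces_int _ (-16)).
(* 1/8^k = 2^k/16^k and 1/(-16)^k = (-1)^k/16^k; the b_k part vanishes by antisymmetry at 2 and -1,
   whose sum is 1. *)
have sum_defect :
  \sum_(0 <= k < p) ('C(2 * k, k) ^ 2)%:R / 8 ^+ k -
    (- \sum_(0 <= k < p) ('C(2 * k, k) ^ 2)%:R / (-16) ^+ k) =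
  p%:R ^+ 2 * (\sum_(0 <= k < p) defect n k * (2 ^+ k + (-1) ^+ k)) :> rat.
  have sum0 : \sum_(0 <= k < p) legendre_coef rat n k * (2 ^+ k + (-1) ^+ k) = 0.
    have odd_n : odd n by rewrite /= odd_double.
    rewrite -[RHS](legendre_antisym rat n 2 (-1) odd_n) (big_cat_nat _ (n := n.+1)) //=; last by lia.
    rewrite [X in _ + X]big_nat [X in _ + X]big1 => [|k /andP[nk _]]; last first.
      by rewrite legendre_coef_small ?mul0r.
    rewrite addr0 big_mkord; apply: eq_bigr => k _.
    by rewrite (_ : 2 - 1 = 1 :> rat) // expr1n mulr1.
  rewrite opprK -big_split -[LHS]subr0 -[X in _ - X]sum0 -sumrB mulr_sumr /=.
  apply: eq_bigr => k _; rewrite /defect -p2n.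
  have -> : (8 ^+ k)^-1 = 2 ^+ k / 16 ^+ k :> rat.
    by rewrite (_ : 16 = 8 * 2 :> rat) // exprMn invfM mulrCA mulfV ?mulr1 // expf_neq0.
  have -> : ((-16) ^+ k)^-1 = (-1) ^+ k / 16 ^+ k :> rat.
    by rewrite exprNn invfM invr_sign.
  rewrite /central_coef; move: ((16 ^+ k)^-1) => s.
  by field; nonzero_side.
rewrite {}sum_defect natrX; set S := \sum_(0 <= k < p) _.
have -> : p%:R ^+ 2 * S / p%:R ^+ 3 = S / p%:R by field.
apply: (@reduces0_integral p 'F_p pF).
(* The target residue 0 is replaced by the vanishing sum in ['F_p], so that the reduction is checked
   termwise. *)
rewrite -(inhomogeneous_values_cancel 'F_p p e pF def_p (reduced_defect n 'F_p)) //; last first.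
  move=> k kp; rewrite /= mulrC divfK // expf_neq0 //.
  by rewrite p2n in pF kp *; apply: (double_neq0 _ _ pF).
apply: reduces_sum => k kp; apply: reducesM.
  by rewrite p2n in pF kp *; apply: reduces_defect.
apply: reducesD; apply: reducesX; first exact: (reduces_nat _ 2).
exact: (reduces_int _ (-1)).
Qed.
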